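(* Let $N$ be a positive integer. There exists an antipodal $5$-design with $2N$ rational points for the Chebyshev measure $(1-t^2)^{-1/2}dt/\pi$ on $(-1,1)$ if and only if $N=3k$ with $k\ge1$, or $N=3k+1$ with $k\ge 6$, or $N=3k+2$ with $k\ge 3$.
   Context: An $m$-design with $n$ points for a probability measure $w(t)dt$ on an interval $I$ is a set of $n$ pairwise distinct points $x_1,\dots,x_n\in I$ with $\frac1n\sum_i f(x_i)=\int_I f(t)w(t)dt$ for every real polynomial $f$ of degree at most $m$. It is rational if all $x_i\in\mathbb{Q}$ and antipodal if $\{x_i\}=\{-x_i\}$. The Chebyshev measure is $w(t)=\frac{1}{\pi\sqrt{1-t^2}}$ on $(-1,1)$. *)

(* Defs.v *)
From HB Require Import structures.
From mathcomp Require Import all_boot all_order all_algebra.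
From mathcomp Require Import all_classical all_reals all_analysis.
Set Implicit Arguments.
Unset Strict Implicit.
Unset Printing Implicit Defensive.
Import Order.TTheory GRing.Theory Num.Theory.
Import numFieldNormedType.Exports.
Local Open Scope classical_set_scope.
Local Open Scope ring_scope.

(* The equation is stated in [\bar R], so that it also asserts that the Lebesgue
   integral of [f * w] over [I] is finite. *)
Definition is_design (R : realType) (w : R -> R) (I : interval R)
    (m n : nat) (x : 'I_n -> R) : Prop :=
  [/\ injective x,
      forall i, x i \in I
    & forall f : {poly R}, (size f <= m.+1)%N ->
        ((n%:R^-1 * \sum_(i < n) f.[x i])%:E
         = \int[lebesgue_measure]_(t in [set` I]) (f.[t] * w t)%:E)%E].

Definition rational_points (R : realType) (n : nat) (x : 'I_n -> R) : Prop :=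
  forall i, exists q : rat, x i = ratr q.

Definition antipodal (R : realType) (n : nat) (x : 'I_n -> R) : Prop :=
  range x = range (fun i => - x i).

Definition chebyshev_weight (R : realType) (t : R) : R :=
  (pi * Num.sqrt (1 - t ^+ 2))^-1.

(* Main.v *)
Require Import Defs.
From HB Require Import structures.
From mathcomp Require Import all_boot all_order all_algebra.
From mathcomp Require Import all_classical all_reals all_analysis.
From mathcomp Require Import measurable_realfun ring lra zify.
Set Implicit Arguments.
Unset Strict Implicit.
Unset Printing Implicit Defensive.
Import Order.TTheory GRing.Theory Num.Theory.
Import numFieldNormedType.Exports.
Local Open Scope classical_set_scope.
Local Open Scope ring_scope.

(* The second and fourth moments of the Chebyshev measure are 1/2 and 3/8, so an
   antipodal 5-design with 2N rational points amounts to N distinct rationals in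
   (0, 1), its positive half, with square sum N/2 and fourth power sum 3N/8.
   Clearing denominators gives 2 sum a^2 = N d^2 and 8 sum a^4 = 3 N d^4, and a
   2-adic descent on d counting the odd a's rules out the small values of N.
   Conversely [|cos t|, |cos (t + 2 pi / 3)|, |cos (t - 2 pi / 3)|] is a solution
   for N = 3, with infinitely many rational instances, and sporadic solutions for
   N = 11 and N = 19 (found by computer search) start the other residue classes. *)

(** * Integrals of polynomials against the Chebyshev measure *)

(** Every real polynomial can be written as [A + (1 - X^2) Q' - X Q], so this supplies an
    antiderivative for any polynomial divided by [sqrt (1 - t^2)]. *)
Lemma is_derive_asin_sqrt (R : realType) (A : R) (Q : {poly R}) (t : R) :
  -1 < t < 1 ->
  is_derive t 1 (fun u => A * asin u + Q.[u] * Num.sqrt (1 - u ^+ 2))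
    ((A%:P + (1 - 'X^2) * Q^`() - 'X * Q).[t] / Num.sqrt (1 - t ^+ 2)).
Proof.
move=> t1; have s0 : 0 < 1 - t ^+ 2 by nra.
have := is_derive1_asin t1 => dasin.
have := is_derive1_sqrt s0 => dsqrt.
have d1 : is_derive t 1 (fun u : R => 1 - u ^+ 2) (- (2 * t)).
  by apply: is_derive_eq; rewrite /GRing.scale/=; ring.
have d2 : is_derive t 1 (fun u : R => Num.sqrt (1 - u ^+ 2))
   ((2 * Num.sqrt (1 - t ^+ 2))^-1 * - (2 * t)).
  exact: (@is_derive1_comp _ Num.sqrt).
apply: is_derive_eq.
have -> : (A%:P + (1 - 'X^2) * Q^`() - 'X * Q).[t]
    = A + (1 - t ^+ 2) * Q^`().[t] - t * Q.[t] by rewrite !hornerE.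
rewrite /GRing.scale/=.
have sn0 : Num.sqrt (1 - t ^+ 2) != 0 by rewrite gt_eqF ?sqrtr_gt0.
have := sqr_sqrtr (ltW s0); set s := Num.sqrt _ in sn0 * => ss.
apply: (mulIf sn0); rewrite divfK//.
by field: ss.
Qed.

Lemma continuous_chebyshev_weight (R : realType) (t : R) :
  -1 < t < 1 -> {for t, continuous (@chebyshev_weight R)}.
Proof.
move=> t1; have s0 : 0 < 1 - t ^+ 2 by nra.
apply: continuousV.
  by rewrite mulf_neq0 ?gt_eqF ?pi_gt0 ?sqrtr_gt0.
apply: cvgM; first exact: cvg_cst.
apply: (@continuous_comp _ _ _ (fun u : R => 1 - u ^+ 2) Num.sqrt).
  by apply: cvgB; [exact: cvg_cst|exact: exprn_continuous].
exact: sqrt_continuous.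
Qed.

Lemma continuous_horner_chebyshev_weight (R : realType) (f : {poly R}) (t : R) :
  -1 < t < 1 -> {for t, continuous (fun u => f.[u] * chebyshev_weight u)}.
Proof.
move=> t1; apply: cvgM; first exact: continuous_horner.
exact: continuous_chebyshev_weight.
Qed.

(** The weight blows up at both ends of (-1, 1), so the fundamental theorem of calculus is first
    applied on a compact interval. Endpoints of the form [sin a] turn [asin] into [a] and the square
    root into [cos a]. *)
Lemma integral_chebyshev_sin (R : realType) (A : R) (Q : {poly R}) (a : R) :
  0 < a < pi / 2 ->
  (\int[lebesgue_measure]_(t in [set` `[(- sin a)%R, sin a]])
      ((A%:P + (1 - 'X^2) * Q^`() - 'X * Q).[t] * chebyshev_weight t)%:E
   = ((A * a + Q.[sin a] * cos a) / pi - (A * - a + Q.[- sin a] * cos a) / pi)%:E)%E.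
Proof.
move=> /andP[a0 a2]; set f : {poly R} := A%:P + _ - _.
have a2I : a \in `[(- (pi / 2)), (pi / 2)] by rewrite in_itv/=; apply/andP; lra.
have Na2I : - a \in `[(- (pi / 2)), (pi / 2)] by rewrite in_itv/=; apply/andP; lra.
have s1 : sin a < 1.
  rewrite -[ltRHS](@sin_pihalf R) ltr_sin// in_itv/=; apply/andP; lra.
have s0 : 0 < sin a.
  rewrite -[ltLHS](@sin0 R) ltr_sin// in_itv/=; apply/andP; lra.
have inI (t : R) : - sin a <= t <= sin a -> -1 < t < 1 by move=> ?; apply/andP; lra.
pose F := fun t : R => (A * asin t + Q.[t] * Num.sqrt (1 - t ^+ 2)) / pi.
have dF (t : R) : -1 < t < 1 -> is_derive t 1 F (f.[t] * chebyshev_weight t).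
  move=> /(is_derive_asin_sqrt A Q) dt.
  have -> : F = (pi^-1 : R) \*: (fun u : R => A * asin u + Q.[u] * Num.sqrt (1 - u ^+ 2)).
    by apply/funext => u; rewrite /F /= mulrC.
  apply: is_derive_eq.
  by rewrite /GRing.scale/= /chebyshev_weight invfM -/f; ring.
have cF (t : R) : -1 < t < 1 -> {for t, continuous F}.
  move=> /dF t1; apply: differentiable_continuous.
  by apply/derivable1_diffP; case: t1.
rewrite (@continuous_FTC2 _ _ F)//.
- have cN : sin (- a) = - sin a by rewrite sinN.
  have sq b : b \in `[(- (pi / 2)), (pi / 2)] -> Num.sqrt (1 - sin b ^+ 2) = cos b.
    move=> bI; rewrite -cos2sin2 sqrtr_sqr ger0_norm//.
    by apply: cos_ge0_pihalf; move: bI; rewrite in_itv.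
  by rewrite /F sinK// -cN sinK// !sq// cosN -EFinB.
- by lra.
- apply: continuous_in_subspaceT => t; rewrite inE/= in_itv/= => /inI.
  exact: continuous_horner_chebyshev_weight.
- split.
  + move=> t; rewrite in_itv/= => /andP[t1 t2].
    by case: (dF t) => //; apply: inI; rewrite !ltW.
  + by apply: cvg_at_right_filter; apply: cF; apply: inI; apply/andP; lra.
  + by apply: cvg_at_left_filter; apply: cF; apply: inI; apply/andP; lra.
- move=> t; rewrite in_itv/= => /andP[t1 t2]; rewrite derive1E.
  have : -1 < t < 1 by apply: inI; rewrite !ltW.
  by move/dF => dt; exact: derive_val.
Qed.

Lemma measurable_horner_chebyshev_weight (R : realType) (f : {poly R}) :
  measurable_fun (`](-1), 1[%classic : set R)
    (fun t : R => f.[t] * chebyshev_weight t).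
Proof.
apply: open_continuous_measurable_fun; first exact: interval_open.
move=> t; rewrite inE/= in_itv/= => ?.
exact: continuous_horner_chebyshev_weight.
Qed.

(** Nonnegativity permits monotone convergence along the intervals [[- sin a, sin a]] as [a] tends
    to pi / 2. The terms in [Q] die with [cos a], and the two [asin] terms add up to [A]. *)
Lemma ge0_integral_chebyshev (R : realType) (A : R) (Q : {poly R}) :
  (forall t : R, -1 < t < 1 -> 0 <= (A%:P + (1 - 'X^2) * Q^`() - 'X * Q).[t]) ->
  (\int[lebesgue_measure]_(t in [set` `](-1)%R, 1%R[])
      ((A%:P + (1 - 'X^2) * Q^`() - 'X * Q).[t] * chebyshev_weight t)%:E
   = A%:E)%E.
Proof.
set f : {poly R} := A%:P + _ - _ => f0.
have pi1 := pihalf_ge1 R.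
(* The shifted index keeps the subtracted term below 1, hence below pi / 2, so that every [a n] is
   strictly positive. *)
pose a n : R := pi / 2 - harmonic n.+1.
have hB n : 0 < (harmonic n.+1 : R) < 1.
  by rewrite /harmonic/= invr_gt0 ltr0n/= invf_lt1 ?ltr0n// ltr1n.
have aB n : 0 < a n < pi / 2 by have := hB n; rewrite /a => ?; apply/andP; lra.
have aI n : a n \in `[(- (pi / 2)), (pi / 2)].
  by have := aB n; rewrite in_itv/= => ?; apply/andP; lra.
have pi2I : pi / 2 \in `[(- (pi / 2)), (pi / 2) : R] by rewrite in_itv/=; apply/andP; lra.
have sB n : 0 < sin (a n) < 1.
  rewrite -[X in X < _ < _](@sin0 R) -[X in _ < _ < X](@sin_pihalf R) !ltr_sin//.
  by rewrite in_itv/=; apply/andP; lra.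
have ca : a n @[n --> \oo] --> (pi / 2 : R).
  rewrite -[X in _ --> X]subr0; apply: cvgB; first exact: cvg_cst.
  by rewrite (cvg_shiftS (@harmonic R)); exact: cvg_harmonic.
have cs : sin (a n) @[n --> \oo] --> (1 : R).
  by rewrite -(@sin_pihalf R); apply: continuous_cvg => //; exact: continuous_sin.
have cc : cos (a n) @[n --> \oo] --> (0 : R).
  by rewrite -(@cos_pihalf R); apply: continuous_cvg => //; exact: continuous_cos.
pose E n := [set` `[(- sin (a n)), sin (a n)]] : set R.
have EU : [set` `](-1), 1[] = \bigcup_n E n.
  apply/seteqP; split => [t /=|t [n _]]; rewrite /E/= !in_itv/=.
    move=> t1; have t2 : `|t| < 1 by rewrite ltr_norml.
    near \oo => n; exists n => //; rewrite /E/= in_itv/= -ler_norml.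
    by near: n; exact: (cvgr_ge 1).
  by have := sB n => ? ?; apply/andP; lra.
have mf := measurable_horner_chebyshev_weight f.
pose I n := (\int[lebesgue_measure]_(t in E n) (f.[t] * chebyshev_weight t)%:E)%E.
have cI : I n @[n --> \oo] --> A%:E.
  rewrite /I; under eq_cvg do rewrite integral_chebyshev_sin//.
  apply: cvg_EFin; first exact: nearW.
  have AE : A = (A * (pi / 2) + Q.[1] * 0) / pi - (A * - (pi / 2) + Q.[-1] * 0) / pi.
    have p0 : pi != 0 :> R by rewrite gt_eqF ?pi_gt0.
    by move: (pi : R) p0 => p p0; field.
  rewrite [X in _ --> X]AE.
  apply: cvgB; (apply: cvgM; last exact: cvg_cst); (apply: cvgD; apply: cvgM) => //.
  + exact: cvg_cst.
  + by apply: continuous_cvg => //; exact: continuous_horner.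
  + exact: cvg_cst.
  + exact: cvgN.
  + by apply: continuous_cvg; [exact: continuous_horner|exact: cvgN].
rewrite EU; apply: (cvg_unique _ _ cI) => //.
apply: ge0_nondecreasing_set_cvg_integral.
- apply/nondecreasing_seqP => n; rewrite subsetEset => t; rewrite /E /= !in_itv/=.
  suff : sin (a n) <= sin (a n.+1) by move=> ? ?; apply/andP; lra.
  rewrite ltW// ltr_sin// /a ltrD2l ltrN2 /harmonic/=.
  by rewrite ltf_pV2 ?posrE ?ltr0n// ltr_nat.
- by move=> n; exact: measurable_itv.
- move=> n; apply/measurable_EFinP; apply: measurable_funS mf => //.
  by rewrite EU; exact: bigcup_sup.
- move=> n t Et; rewrite lee_fin mulr_ge0//.
    have : (\bigcup_n E n) t by exists n.
    by rewrite -EU/= in_itv; exact: f0.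
  by rewrite invr_ge0 mulr_ge0 ?sqrtr_ge0// pi_ge0.
Unshelve. all: by end_near. Qed.

Lemma horner_lower_bound (R : realType) (p : {poly R}) :
  exists2 c : R, 0 <= c & forall t, -1 < t < 1 -> 0 <= p.[t] + c.
Proof.
exists (\sum_(i < size p) `|p`_i|) => [|t t1]; first exact: sumr_ge0.
rewrite horner_coef -big_split/=; apply: sumr_ge0 => i _.
rewrite -lerBlDr sub0r lerNl; apply: le_trans (ler_norm _) _.
rewrite normrN normrM ler_piMr// normrX exprn_ile1//.
by rewrite ler_norml; apply/andP; lra.
Qed.

(** A large constant [c] makes [f + c] nonnegative on (-1, 1). The nonnegative case covers both
    [f + c] and [c] itself (with [Q = 0]), and the finite values give the integrability needed to
    subtract. *)
Lemma integral_chebyshev (R : realType) (A : R) (Q : {poly R}) :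
  (\int[lebesgue_measure]_(t in [set` `](-1)%R, 1%R[])
      ((A%:P + (1 - 'X^2) * Q^`() - 'X * Q).[t] * chebyshev_weight t)%:E
   = A%:E)%E.
Proof.
set f : {poly R} := A%:P + _ - _.
have [c c0 fc] := horner_lower_bound f.
have gE : (A + c)%:P + (1 - 'X^2) * Q^`() - 'X * Q = f + c%:P.
  by rewrite /f polyCD; ring.
have cE : c%:P + (1 - 'X^2) * (0 : {poly R})^`() - 'X * 0 = c%:P.
  by rewrite deriv0; ring.
have wi (B : R) (q : {poly R}) :
    (forall t : R, -1 < t < 1 -> 0 <= q.[t]) ->
    (\int[lebesgue_measure]_(t in [set` `](-1)%R, 1%R[])
       (q.[t] * chebyshev_weight t)%:E = B%:E)%E ->
    lebesgue_measure.-integrable (`](-1), 1[%classic : set R)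
      (fun t => (q.[t] * chebyshev_weight t)%:E).
  move=> q0 qB; apply/integrableP; split.
    by apply/measurable_EFinP; exact: measurable_horner_chebyshev_weight.
  under eq_integral => t.
    rewrite inE/= in_itv/= => t1.
    rewrite ger0_norm; last first.
      by rewrite mulr_ge0 ?q0// invr_ge0 mulr_ge0 ?sqrtr_ge0// pi_ge0.
    over.
  by rewrite qB ltry.
have i1 : (\int[lebesgue_measure]_(t in [set` `](-1)%R, 1%R[])
    ((f + c%:P).[t] * chebyshev_weight t)%:E = (A + c)%:E)%E.
  rewrite -gE ge0_integral_chebyshev// => t t1.
  by rewrite gE hornerD hornerC fc.
have i2 : (\int[lebesgue_measure]_(t in [set` `](-1)%R, 1%R[])
    (c%:P.[t] * chebyshev_weight t)%:E = c%:E)%E.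
  by rewrite -cE ge0_integral_chebyshev// => t t1; rewrite cE hornerC.
under eq_integral => t _.
  have -> : f.[t] * chebyshev_weight t
      = (f + c%:P).[t] * chebyshev_weight t - c%:P.[t] * chebyshev_weight t.
    by rewrite hornerD; ring.
  over.
rewrite integralB_EFin//; last 2 first.
- by apply: wi i1 => t t1; rewrite hornerD hornerC fc.
- by apply: wi i2 => t t1; rewrite hornerC.
by rewrite i1 i2 -EFinB addrK.
Qed.

Lemma integral_chebyshev_deg5 (R : realType) (f : {poly R}) : (size f <= 6)%N ->
  (\int[lebesgue_measure]_(t in [set` `](-1)%R, 1%R[])
      (f.[t] * chebyshev_weight t)%:E
   = (f`_0 + f`_2 / 2 + 3 / 8 * f`_4)%:E)%E.
Proof.
move=> f6.
(* Comparing coefficients of [X^i] gives [(i + 1) q_(i+1) - i q_(i-1) = f_i] for i > 0, solved from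
   i = 5 downwards. The constant coefficient then gives [A = f_0 - q_1]. *)
pose q4 := - f`_5 / 5; pose q3 := - f`_4 / 4; pose q2 := (4 * q4 - f`_3) / 3.
pose q1 := (3 * q3 - f`_2) / 2; pose q0 := 2 * q2 - f`_1.
pose Q := Poly [:: q0; q1; q2; q3; q4].
set A := f`_0 + _ + _.
suff <- : A%:P + (1 - 'X^2) * Q^`() - 'X * Q = f by exact: integral_chebyshev.
apply/polyP => i.
rewrite mulrBl mul1r coefB coefD coefB coefXM coefXnM coefC !coef_deriv !coef_Poly.
case: i => [|[|[|[|[|[|i]]]]]] /=.
1-6: by rewrite ?subn2 /A /q0 /q1 /q2 /q3 /q4 /=; field.
rewrite [f`__]nth_default ?(leq_trans f6)//.
by rewrite !nth_nil; case: i => [|[|i]] /=; rewrite ?nth_nil; ring.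
Qed.

(** * The 2-adic obstruction for rational half-designs *)

Definition half_design (F : realFieldType) (N : nat) (s : seq F) : Prop :=
  [/\ uniq s, all (fun x : F => 0 < x < 1) s, size s = N,
      \sum_(x <- s) x ^+ 2 = N%:R / 2 & \sum_(x <- s) x ^+ 4 = 3 / 8 * N%:R].

Lemma sum_sqr_mod4 (s : seq nat) :
  exists k, (\sum_(a <- s) a ^ 2 = count odd s + 4 * k)%N.
Proof.
elim: s => [|a s [k IH]]; first by exists 0%N; rewrite big_nil.
rewrite big_cons IH /=; have := odd_double_half a; set b := a./2.
case: (odd a) => /= <-.
- by exists (k + b * b + b)%N; rewrite -mul2n; nia.
- by exists (k + b * b)%N; rewrite -mul2n; nia.
Qed.

Lemma odd_sqrE (b : nat) : exists c, ((1 + 2 * b) ^ 2 = 1 + 8 * c)%N.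
Proof.
elim: b => [|b [c IH]]; first by exists 0%N.
by exists (c + b + 1)%N; lia.
Qed.

Lemma pow4_sqr (a : nat) : (a ^ 4 = (a ^ 2) ^ 2)%N.
Proof. by rewrite -expnM. Qed.

Lemma pow4_mod16 (a : nat) : exists k, (a ^ 4 = odd a + 16 * k)%N.
Proof.
have := odd_double_half a; set b := a./2.
case: (odd a) => /= <-; rewrite -mul2n pow4_sqr.
- have [c ->] := odd_sqrE b.
  by exists (c + 4 * c ^ 2)%N; lia.
- by exists (b ^ 4)%N; rewrite pow4_sqr; lia.
Qed.

Lemma sum_pow4_mod16 (s : seq nat) :
  exists k, (\sum_(a <- s) a ^ 4 = count odd s + 16 * k)%N.
Proof.
elim: s => [|a s [k IH]]; first by exists 0%N; rewrite big_nil.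
rewrite big_cons IH /=; have [c ->] := pow4_mod16 a.
by exists (k + c)%N; lia.
Qed.

(** For odd [a], [a^4 + 1 - 2 a^2] is the square of [a^2 - 1], a multiple of 8. *)
Lemma sum_odd_mod64 (s : seq nat) : all odd s ->
  exists k, (\sum_(a <- s) a ^ 4 + size s = 2 * \sum_(a <- s) a ^ 2 + 64 * k)%N.
Proof.
elim: s => [|a s IH]; first by exists 0%N; rewrite !big_nil.
move=> /= /andP[oa /IH[k Hk]]; rewrite !big_cons.
have := odd_double_half a; rewrite oa /= => <-; rewrite -mul2n pow4_sqr.
have [c ->] := odd_sqrE a./2.
by exists (k + c ^ 2)%N; lia.
Qed.

(* The fourth power sum is congruent to the number of odd terms modulo 16; for
   [d] even and no odd term, halving everything gives a smaller solution. *)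
Lemma nat_moments_obstruction (s : seq nat) (d : nat) : (0 < d)%N ->
  (2 * \sum_(a <- s) a ^ 2 = size s * d ^ 2)%N ->
  (8 * \sum_(a <- s) a ^ 4 = 3 * size s * d ^ 4)%N ->
  size s \notin [:: 1; 2; 4; 5; 7; 8; 10; 13; 16]%N.
Proof.
have [n] := ubnP d; elim: n => // n IH in d s *.
rewrite ltnS => dn d0 S2 S4; apply/negP => Ns.
have [k2 E2] := sum_sqr_mod4 s; have [k4 E4] := sum_pow4_mod16 s.
have qN := count_size odd s.
have := odd_double_half d; case: (odd d) => /= dE.
  (* Let N be the size and q the number of odd terms. For odd [d] the fourth powers force 8 to
     divide N, so N is 8 or 16. Then q is 3 or 6 modulo 16, whereas the squares make q divisible by
     4. *)
  have [c dc] := odd_sqrE d./2.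
  move: S2 S4; rewrite pow4_sqr -dE -mul2n dc E2 E4.
  by move: Ns; rewrite !inE; lia.
move: dE; rewrite add0n -mul2n; set e := d./2 => dE.
have {}S2 : (\sum_(a <- s) a ^ 2 = 2 * size s * e ^ 2)%N by rewrite -dE in S2; lia.
have {}S4 : (\sum_(a <- s) a ^ 4 = 6 * size s * e ^ 4)%N.
  by move: S4; rewrite -dE expnMn; lia.
have [q0|q0] := posnP (count odd s).
  have ev : all (predC odd) s by rewrite all_predC has_count q0.
  have hs : s = [seq 2 * a | a <- [seq a./2 | a <- s]]%N.
    rewrite -map_comp -[LHS]map_id; apply/eq_in_map => a /(allP ev)/= oa.
    by rewrite mul2n even_halfK.
  move: (IH e [seq a./2 | a <- s]); rewrite size_map Ns.
  move: S2 S4; rewrite {1 3}hs !big_map.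
  have -> : (\sum_(j <- s) (2 * j./2) ^ 2 = 4 * \sum_(j <- s) j./2 ^ 2)%N.
    by rewrite big_distrr; apply: eq_bigr => j _ /=; rewrite expnMn.
  have -> : (\sum_(j <- s) (2 * j./2) ^ 4 = 16 * \sum_(j <- s) j./2 ^ 4)%N.
    by rewrite big_distrr; apply: eq_bigr => j _ /=; rewrite expnMn.
  move=> S2 S4 H; have: ~~ true; last by [].
  by apply: H; lia.
have [k Ek] := pow4_mod16 e.
(* With some but not all terms odd, 0 < q < N and q is congruent to [6 N e^4] modulo 16. For even
   [e] this residue is 0, for odd [e] it is that of 6 N; no listed N admits such a q. *)
have [qs|qs] := eqVneq (count odd s) (size s); last first.
  by move: E2 E4 qs Ns; rewrite S2 S4 Ek !inE; case: (odd e) => /=; lia.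
(* If all terms are odd, q = N and the congruence modulo 16 leaves only N = 16. Then [96 e^4 + 16]
   would be a multiple of 64, which fails already modulo 32. *)
have /sum_odd_mod64[m] : all odd s by rewrite all_count qs.
rewrite S2 S4.
by move: E2 E4 qs Ns; rewrite S2 S4 Ek !inE; case: (odd e) => /=; lia.
Qed.

Lemma common_denominator (s : seq rat) : all (fun x => 0 <= x) s ->
  exists (d : nat) (a : seq nat),
    (0 < d)%N /\ s = [seq n%:R / d%:R | n <- a].
Proof.
elim: s => [|x s IH] /=; first by exists 1%N, [::].
move=> /andP[x0 /IH[d [a [d0 ->]]]].
have m0 : (0 < `|denq x|)%N by rewrite absz_gt0 denq_neq0.
have xE : x = `|numq x|%N%:R / `|denq x|%N%:R.
  by rewrite -{1}[x]divq_num_den !natr_absz !ger0_norm ?denq_ge0// numq_ge0.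
have nz n : (0 < n)%N -> n%:R != 0 :> rat by rewrite pnatr_eq0 lt0n.
exists (`|denq x| * d)%N, ((`|numq x| * d)%N :: [seq (`|denq x| * n)%N | n <- a]).
split; first by rewrite muln_gt0 m0.
rewrite map_cons -map_comp; congr (_ :: _).
  by rewrite {1}xE !natrM -mulf_div divff ?mulr1// nz.
apply: eq_map => n /=.
by rewrite !natrM -mulf_div divff ?mul1r// nz.
Qed.

Lemma half_design_obstruction (N : nat) (s : seq rat) :
  half_design N s -> N \notin [:: 1; 2; 4; 5; 7; 8; 10; 13; 16]%N.
Proof.
move=> [_ s01 <- S2 S4].
have [|d [a [d0 sE]]] := @common_denominator s.
  by apply: sub_all s01 => x /andP[/ltW].
have dn0 : d%:R != 0 :> rat by rewrite pnatr_eq0 -lt0n.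
have sumE k : \sum_(x <- s) x ^+ k = (\sum_(n <- a) n ^ k)%N%:R / d%:R ^+ k.
  rewrite sE big_map natr_sum mulr_suml.
  by apply: eq_bigr => n _; rewrite expr_div_n natrX.
have sz : size s = size a by rewrite sE size_map.
rewrite sz; apply: (nat_moments_obstruction d0); rewrite -sz;
  apply/eqP; rewrite -(eqr_nat rat).
- rewrite (natrM _ 2) (natrM _ (size s)) natrX; apply/eqP.
  move: S2; rewrite sumE => /(canRL (divfK (expf_neq0 2 dn0))) ->.
  by field.
- rewrite (natrM _ 8) (natrM _ (3 * size s)) (natrM _ 3) natrX; apply/eqP.
  move: S4; rewrite sumE => /(canRL (divfK (expf_neq0 4 dn0))) ->.
  by field.
Qed.

(** * Construction of half-designs from cosine triples and two seeds *)

(* A rational parametrisation of the absolute values of the cosines of [t],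
   [t + 2 pi / 3] and [t - 2 pi / 3]. *)
Definition triple_low (F : realFieldType) (n : nat) : F :=
  1 / 2 - 3 * n.+1%:R / (2 * (n ^ 2 + n + 1)%:R).
Definition triple_mid (F : realFieldType) (n : nat) : F :=
  1 / 2 + 3 * n%:R / (2 * (n ^ 2 + n + 1)%:R).
Definition triple_top (F : realFieldType) (n : nat) : F :=
  1 - 3 / (2 * (n ^ 2 + n + 1)%:R).

(** For three angles spaced by 2 pi / 3, the sums of the cosines of the doubled and of the
    quadrupled angles vanish, which fixes both power sums. Algebraically, top = low + mid, so the
    fourth power sum is half the square of the square sum. *)
Lemma triple_moments (F : realFieldType) (n : nat) :
  triple_low F n ^+ 2 + triple_mid F n ^+ 2 + triple_top F n ^+ 2 = 3 / 2 /\
  triple_low F n ^+ 4 + triple_mid F n ^+ 4 + triple_top F n ^+ 4 = 9 / 8.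
Proof.
have D0 : n%:R ^+ 2 + n%:R + 1 != 0 :> F.
  by rewrite gt_eqF// ltr_wpDl ?addr_ge0// exprn_ge0.
rewrite /triple_low /triple_mid /triple_top !natrD -[n.+1]addn1 natrD natrX.
by move: (n%:R : F) D0 => t D0; split; field.
Qed.

(** Since top = low + mid, low > 0 and mid < top are the same inequality [3 (n + 1) < n^2 + n + 1],
    which holds from n = 3 on. *)
Lemma triple_bounds (F : realFieldType) (n : nat) : (3 <= n)%N ->
  [&& 0 < triple_low F n, triple_low F n < triple_mid F n,
      triple_mid F n < triple_top F n & triple_top F n < 1].
Proof.
rewrite -(ler_nat F) /triple_low /triple_mid /triple_top !natrD -[n.+1]addn1 natrD natrX.
move: (n%:R : F) => t t3.
have D0 : 0 < 2 * (t ^+ 2 + t + 1) by nra.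
have a1 : 3 * (t + 1) / (2 * (t ^+ 2 + t + 1)) < 1 / 2.
  by rewrite ltr_pdivrMr//; nra.
have a2 : 0 < 3 * (t + 1) / (2 * (t ^+ 2 + t + 1)) by rewrite divr_gt0//; lra.
have a3 : 0 < 3 * t / (2 * (t ^+ 2 + t + 1)) by rewrite divr_gt0//; lra.
have a4 : 3 * t / (2 * (t ^+ 2 + t + 1)) + 3 / (2 * (t ^+ 2 + t + 1)) < 1 / 2.
  by rewrite -mulrDl -[3 in X in _ + X]mulr1 -mulrDr.
have a5 : 0 < 3 / (2 * (t ^+ 2 + t + 1)) by rewrite divr_gt0//; lra.
by apply/and4P; split; lra.
Qed.

Lemma triple_mono (F : realFieldType) (n : nat) : (1 <= n)%N ->
  [&& triple_low F n < triple_low F n.+1, triple_mid F n.+1 < triple_mid F n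
    & triple_top F n < triple_top F n.+1].
Proof.
rewrite -(ler_nat F) /triple_low /triple_mid /triple_top !natrD.
rewrite -[n.+2]addn1 -[n.+1]addn1 !natrX !natrD.
move: (n%:R : F) => t t1.
have D0 : 0 < 2 * (t ^+ 2 + t + 1) by nra.
have D1 : 0 < 2 * ((t + 1) ^+ 2 + (t + 1) + 1) by nra.
apply/and3P; split.
- rewrite ltrD2l ltrN2 ltr_pdivrMr// mulrAC ltr_pdivlMr//; nra.
- rewrite ltrD2l ltr_pdivrMr// mulrAC ltr_pdivlMr//; nra.
- rewrite ltrD2l ltrN2 ltr_pdivrMr// mulrAC ltr_pdivlMr//; nra.
Qed.

(* This leaves room for all triples of index at least [n]: as the index grows,
   [triple_low] and [triple_top] increase and [triple_mid] decreases. *)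
Definition separated (F : realFieldType) (n : nat) (x : F) : bool :=
  (x < triple_low F n) || (triple_mid F n < x < triple_top F n).

(** Each step adjoins the triple of index [n + k]. Separation makes its three values new, and
    monotonicity in the index makes the longer list separated from all later triples. *)
Lemma half_design_triples (F : realFieldType) (N n k : nat) (s : seq F) : (3 <= n)%N ->
  half_design N s -> all (separated n) s ->
  exists2 s' : seq F, half_design (N + 3 * k) s' & all (separated (n + k)) s'.
Proof.
move=> n3 hs sn; elim: k => [|k [s' [us s01 sz S2 S4] sn']].
  by exists s; rewrite ?muln0 ?addn0.
rewrite addnS; set m := (n + k)%N in sn' *.
have m3 : (3 <= m)%N by rewrite (leq_trans n3)// leq_addr.
have /and4P[b1 b2 b3 b4] := triple_bounds F m3.
have /(triple_mono F)/and3P[c1 c2 c3] : (1 <= m)%N by apply: leq_trans m3.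
have [T2 T4] := triple_moments F m.
rewrite /separated in sn' *.
move: (triple_low F m) (triple_mid F m) (triple_top F m)
  (triple_low F m.+1) (triple_mid F m.+1) (triple_top F m.+1)
  b1 b2 b3 b4 c1 c2 c3 T2 T4 sn' => l u v l' u' v' b1 b2 b3 b4 c1 c2 c3 T2 T4 sn'.
have nin x : x \in [:: l; u; v] -> x \notin s'.
  move=> xm; apply/negP => /(allP sn').
  by move: xm; rewrite !inE => /or3P[] /eqP ->; lra.
exists [:: l, u, v & s']; last first.
  rewrite /=; apply/and4P; split; [lra|lra|lra|].
  by apply: sub_all sn' => x; lra.
rewrite mulnS [(3 + _)%N]addnC addnA.
split.
- rewrite /= !inE us !negb_or !nin ?inE ?eqxx ?orbT//.
  by rewrite (lt_eqF b2) (lt_eqF b3) (lt_eqF (lt_trans b2 b3)).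
- by rewrite /= s01 andbT; apply/and3P; split; apply/andP; lra.
- by rewrite /= sz addn3.
- by rewrite !big_cons S2 [in RHS]natrD; lra.
- by rewrite !big_cons S4 [in RHS]natrD; lra.
Qed.

(** The thresholds are fitted to the two seeds below: neither has a point in [9/19, 3/5] or at
    99/100 and above. The tightest case is 48/102, just below 9/19. *)
Lemma triple_far (F : realFieldType) (n : nat) : (60 <= n)%N ->
  [&& 9 / 19 < triple_low F n, triple_mid F n < 3 / 5 & 99 / 100 < triple_top F n].
Proof.
rewrite -(ler_nat F) /triple_low /triple_mid /triple_top !natrD -[n.+1]addn1 natrD natrX.
move: (n%:R : F) => t t60.
have D0 : 0 < 2 * (t ^+ 2 + t + 1) by nra.
have a1 : 3 * (t + 1) / (2 * (t ^+ 2 + t + 1)) < 1 / 38.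
  by rewrite ltr_pdivrMr//; nra.
have a2 : 3 * t / (2 * (t ^+ 2 + t + 1)) < 1 / 10.
  by rewrite ltr_pdivrMr//; nra.
have a3 : 3 / (2 * (t ^+ 2 + t + 1)) < 1 / 100.
  by rewrite ltr_pdivrMr//; nra.
by apply/and3P; split; lra.
Qed.

Lemma uniq_map_natdiv (F : realFieldType) (d : nat) (a : seq nat) :
  (0 < d)%N -> uniq a -> uniq [seq n%:R / d%:R : F | n <- a].
Proof.
move=> d0 ua; rewrite map_inj_uniq// => m n.
by move=> /(mulIf _)/eqP; rewrite eqr_nat invr_eq0 pnatr_eq0 -lt0n => /(_ d0)/eqP.
Qed.

(** Cross-multiplying the thresholds of [triple_far] leaves comparisons of natural numbers, which
    computation settles for an explicit list. *)
Lemma all_natdiv (F : realFieldType) (d : nat) (a : seq nat) : (0 < d)%N ->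
  all (fun n => (0 < n < d)%N && ((19 * n < 9 * d)%N ||
                (3 * d < 5 * n)%N && (100 * n < 99 * d)%N)) a ->
  all (fun x => (0 < x < 1) && separated 60 x) [seq n%:R / d%:R : F | n <- a].
Proof.
have /and3P[l60 u60 v60] := @triple_far F 60 isT.
rewrite -(ltr_nat F) all_map => d0; apply: sub_all => n /=.
rewrite -!(ltr_nat F) !natrM => /andP[/andP[n0 nd] h].
rewrite divr_gt0// ltr_pdivrMr// mul1r nd /separated /=.
have xE : n%:R = n%:R / d%:R * d%:R :> F by rewrite divfK// gt_eqF.
move: (triple_low F 60) (triple_mid F 60) (triple_top F 60)
  (n%:R / d%:R : F) l60 u60 v60 xE h
  => l u v x l60 u60 v60 ->.
move: (d%:R : F) d0 {nd} => {}d d0; rewrite !mulrA !ltr_pM2r//; lra.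
Qed.

Lemma half_design_seed11 (F : realFieldType) :
  exists2 s : seq F, half_design 11 s & all (separated 60) s.
Proof.
(* Here [e = 39] is odd, and the congruence modulo 16 of the obstruction asks for 2 odd numerators
   modulo 16: they are 65 and 77. *)
pose a := [:: 6; 10; 26; 30; 50; 64; 65; 68; 70; 74; 77]%N.
have := @all_natdiv F 78 a isT isT; rewrite all_predI => /andP[a01 asep].
exists [seq n%:R / 78%:R | n <- a] => //; split => //.
- exact: uniq_map_natdiv.
- by rewrite /= !big_cons big_nil; field.
- by rewrite /= !big_cons big_nil; field.
Qed.

Lemma half_design_seed19 (F : realFieldType) :
  exists2 s : seq F, half_design 19 s & all (separated 60) s.
Proof.
(* The same congruence, with [e = 51], again asks for 2 odd numerators modulo 16: they are 75 and
   99. *)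
pose a := [:: 6; 8; 12; 14; 30; 42; 48; 66; 75; 80; 82; 86; 88; 90; 92; 96;
              98; 99; 100]%N.
have := @all_natdiv F 102 a isT isT; rewrite all_predI => /andP[a01 asep].
exists [seq n%:R / 102%:R | n <- a] => //; split => //.
- exact: uniq_map_natdiv.
- by rewrite /= !big_cons big_nil; field.
- by rewrite /= !big_cons big_nil; field.
Qed.

Lemma half_design_exists (F : realFieldType) (N : nat) :
  [\/ exists2 k : nat, (1 <= k)%N & N = (3 * k)%N,
      exists2 k : nat, (6 <= k)%N & N = (3 * k + 1)%N
    | exists2 k : nat, (3 <= k)%N & N = (3 * k + 2)%N] ->
  exists s : seq F, half_design N s.
Proof.
case=> -[k k0 ->].
- have h0 : half_design 0 ([::] : seq F) by split; rewrite // big_nil; lra.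
  have [s hs _] := @half_design_triples F 0 60 k [::] isT h0 isT.
  by exists s.
- have [s0 h0 s0_sep] := half_design_seed19 F.
  have [s hs _] := @half_design_triples F _ 60 (k - 6) _ isT h0 s0_sep.
  have <- : (19 + 3 * (k - 6) = 3 * k + 1)%N by lia.
  by exists s.
- have [s0 h0 s0_sep] := half_design_seed11 F.
  have [s hs _] := @half_design_triples F _ 60 (k - 3) _ isT h0 s0_sep.
  have <- : (11 + 3 * (k - 3) = 3 * k + 2)%N by lia.
  by exists s.
Qed.

Lemma half_designP (N : nat) : (0 < N)%N ->
  (exists s : seq rat, half_design N s) <->
  [\/ exists2 k : nat, (1 <= k)%N & N = (3 * k)%N,
      exists2 k : nat, (6 <= k)%N & N = (3 * k + 1)%N
    | exists2 k : nat, (3 <= k)%N & N = (3 * k + 2)%N].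
Proof.
move=> N0; split; last exact: half_design_exists.
(* The nine excluded sizes are exactly the numbers 3k + 1 with k < 6 and 3k + 2 with k < 3. *)
move=> [s /half_design_obstruction]; rewrite !inE => Nn.
have N3 := divn_eq N 3; have := ltn_pmod N (isT : (0 < 3)%N).
case: (N %% 3)%N N3 => [|[|[|]]]// N3 _.
- by apply: Or31; exists (N %/ 3)%N; lia.
- by apply: Or32; exists (N %/ 3)%N; lia.
- by apply: Or33; exists (N %/ 3)%N; lia.
Qed.

(** * Passage between half-designs and antipodal designs *)

Lemma even_part_sum (R : realType) (f : {poly R}) (y : R) : (size f <= 6)%N ->
  f.[y] + f.[- y] = 2 * (f`_0 + f`_2 * y ^+ 2 + f`_4 * y ^+ 4).
Proof.
move=> f6; rewrite !(horner_coef_wide _ f6) !big_ord_recl !big_ord0 /=.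
by rewrite /bump /=; ring.
Qed.

Lemma half_design_design (R : realType) (N : nat) (s : seq rat) : (0 < N)%N ->
  half_design N s ->
  exists x : 'I_(2 * N)%N -> R,
    [/\ is_design (@chebyshev_weight R) `](-1), 1[ 5 x,
        rational_points x & antipodal x].
Proof.
move=> N0 [us s01 sN S2 S4].
pose t := s ++ [seq - x | x <- s].
have tN : size t = (2 * N)%N by rewrite size_cat size_map sN mul2n addnn.
have sgt0 y : y \in s -> 0 < y < 1 by move/(allP s01).
have mem_t y : (y \in t) = (y \in s) || (- y \in s).
  rewrite mem_cat; congr orb; apply/mapP/idP => [[z zs ->]|ys]; first by rewrite opprK.
  by exists (- y); rewrite ?opprK.
have ut : uniq t.
  rewrite cat_uniq us map_inj_uniq ?us ?andbT/=; last exact: oppr_inj.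
  apply/hasPn => y /mapP[z /sgt0 z0 ->]; apply/negP => /sgt0; lra.
pose x (i : 'I_(2 * N)) : R := ratr (nth 0 t i).
have ti (i : 'I_(2 * N)) : nth 0 t i \in t by rewrite mem_nth// tN.
exists x; split.
- split.
  + by move=> i j /(fmorph_inj _)/eqP; rewrite nth_uniq ?tN// => /eqP; exact: val_inj.
  + move=> i; rewrite in_itv/= /x -[1](rmorph1 (@ratr R)) -rmorphN !ltr_rat.
    by have := ti i; rewrite mem_t => /orP[] /sgt0; lra.
  + move=> f f6; rewrite integral_chebyshev_deg5//; congr EFin.
    have -> : \sum_(i < 2 * N) f.[x i] = \sum_(y <- t) f.[ratr y].
      by rewrite (big_nth 0) tN big_mkord.
    rewrite big_cat big_map /= -big_split /=.
    under eq_bigr do rewrite rmorphN even_part_sum//.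
    rewrite -big_distrr !big_split/= -!big_distrr/= big_const_seq count_predT sN.
    rewrite iter_addr_0 -mulr_natl.
    under eq_bigr do rewrite -rmorphXn.
    under [X in _ + _ * X]eq_bigr do rewrite -rmorphXn.
    rewrite -!rmorph_sum/= S2 S4 !(rmorphM, fmorphV, rmorph_nat) natrM.
    by field; rewrite pnatr_eq0 -lt0n.
- by move=> i; exists (nth 0 t i).
- have oppx (i : 'I_(2 * N)) : exists j, x j = - x i.
    (* The list [t] is closed under negation, so the antipode of a point is found at the index of
       its negative in [t]. *)
    pose y := - nth 0 t i; have ilt : (index y t < 2 * N)%N.
      by rewrite -tN index_mem mem_t opprK orbC -mem_t.
    by exists (Ordinal ilt); rewrite /x/= nth_index ?rmorphN// -index_mem tN.
  apply/seteqP; split => _ [i _ <-]; have [j xj] := oppx i; exists j => //.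
  by rewrite xj opprK.
Qed.

(** Only 0, being its own negative, could be missed by the splitting; its presence would make the
    size of [q] odd. *)
Lemma symmetric_half (q : seq rat) (N : nat) : uniq q -> size q = (2 * N)%N ->
  (forall y, y \in q -> - y \in q) ->
  perm_eq q ([seq y <- q | 0 < y] ++ [seq - y | y <- [seq y <- q | 0 < y]]).
Proof.
move=> uq qN qopp; set s := [seq y <- q | 0 < y].
have us : uniq s by exact: filter_uniq.
have mem_s y : (y \in s) = (0 < y) && (y \in q) by rewrite mem_filter.
have mem_Ns y : (y \in [seq - z | z <- s]) = (y < 0) && (y \in q).
  apply/mapP/andP => [[z]|[y0 yq]].
    by rewrite mem_s => /andP[z0 zq] ->; rewrite oppr_lt0 z0 qopp.
  by exists (- y); rewrite ?opprK// mem_s oppr_gt0 y0 qopp.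
have ut : uniq (s ++ [seq - y | y <- s]).
  rewrite cat_uniq us map_inj_uniq ?us ?andbT/=; last exact: oppr_inj.
  apply/hasPn => y; rewrite mem_Ns mem_s => /andP[y0 _]; by rewrite lt_gtF.
apply: uniq_perm => // y; rewrite mem_cat mem_s mem_Ns.
case: (ltgtP y 0) => [_|_|y0] /=; rewrite ?orbF//; apply/negbTE/negP => yq.
have : perm_eq q (0 :: s ++ [seq - y | y <- s]).
  apply: uniq_perm => //.
    by rewrite cons_uniq ut mem_cat mem_s mem_Ns ltxx.
  move=> z; rewrite inE mem_cat mem_s mem_Ns.
  by case: (ltgtP z 0) => [_|_|->]; rewrite ?orbF -?y0.
by move/perm_size; rewrite qN /= size_cat size_map; lia.
Qed.

Lemma design_half_design (R : realType) (N : nat) (x : 'I_(2 * N)%N -> R) :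
  (0 < N)%N -> is_design (@chebyshev_weight R) `](-1), 1[ 5 x ->
  rational_points x -> antipodal x -> exists s : seq rat, half_design N s.
Proof.
move=> N0 [xinj x1 xint] /choice[q xq] xN.
have xE k : \sum_i x i ^+ k = ratr (\sum_i q i ^+ k).
  by rewrite rmorph_sum/=; apply: eq_bigr => i _; rewrite xq rmorphXn.
(* Testing the design on the monomials [X^2] and [X^4] yields the two power sums. They are
   transported to [rat] through the injectivity of [ratr]. *)
have qk k c : (k <= 5)%N -> ('X^k`_0 + 'X^k`_2 / 2 + 3 / 8 * 'X^k`_4 = ratr c :> R) ->
    \sum_i q i ^+ k = c * (2 * N)%:R.
  move=> k5 kc; apply: (fmorph_inj (@ratr R)); rewrite /= -xE rmorphM/= -kc rmorph_nat.
  have k6 : (size ('X^k : {poly R}) <= 6)%N by rewrite size_polyXn.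
  have := xint _ k6; rewrite integral_chebyshev_deg5// => -[<-].
  under [in RHS]eq_bigr do rewrite hornerXn.
  by rewrite [RHS]mulrC mulVKf// pnatr_eq0 muln_eq0 negb_or -!lt0n.
have q2 : \sum_i q i ^+ 2 = 1 / 2 * (2 * N)%:R.
  by apply: qk => //; rewrite !coefXn/= !(rmorphM, fmorphV, rmorph_nat); field.
have q4 : \sum_i q i ^+ 4 = 3 / 8 * (2 * N)%:R.
  by apply: qk => //; rewrite !coefXn/= !(rmorphM, fmorphV, rmorph_nat); field.
pose l := [seq q i | i <- enum 'I_(2 * N)].
have ul : uniq l.
  rewrite map_inj_uniq ?enum_uniq// => i j qij.
  by apply: xinj; rewrite !xq qij.
have lN : size l = (2 * N)%N by rewrite size_map size_enum_ord.
have lopp y : y \in l -> - y \in l.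
  move=> /mapP[i _ ->].
  have : range x (- x i) by rewrite xN; exists i.
  move=> [j _ xj]; apply/mapP; exists j; first by rewrite mem_enum.
  by apply: (fmorph_inj (@ratr R)); rewrite /= rmorphN/= -!xq.
have lperm := symmetric_half ul lN lopp.
set s := [seq y <- l | 0 < y] in lperm.
(* An even power takes the same value at [y] and [- y], so the positive points carry exactly half of
   the sum. *)
have lsum k : ~~ odd k -> \sum_i q i ^+ k = 2 * \sum_(y <- s) y ^+ k.
  move=> ek; rewrite -big_enum -(big_map q xpredT (fun y => y ^+ k)) -/l.
  rewrite (perm_big _ lperm) big_cat big_map/= mulr2n mulrDl !mul1r; congr +%R.
  by apply: eq_bigr => y _; rewrite exprNn -signr_odd (negbTE ek) mul1r.
exists s; split.
- exact: filter_uniq.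
- apply/allP => y; rewrite mem_filter => /andP[-> /mapP[i _ ->]] /=.
  have := x1 i; rewrite in_itv/= => /andP[_]; rewrite xq -[X in _ < X](rmorph1 (@ratr R)).
  by rewrite ltr_rat.
- have := perm_size lperm; rewrite lN size_cat (size_map -%R) addnn -mul2n.
  by move/eqP; rewrite eqn_pmul2l// => /eqP.
- by move: q2; rewrite lsum// natrM; lra.
- by move: q4; rewrite lsum// natrM; lra.
Qed.

Theorem theorem1p4 (R : realType) (N : nat) (N_gt0 : (0 < N)%N) :
  (exists x : 'I_(2 * N)%N -> R,
     [/\ is_design (@chebyshev_weight R) `](-1), 1[ 5 x,
         rational_points x
       & antipodal x])
  <->
  [\/ exists2 k : nat, (1 <= k)%N & N = (3 * k)%N,
      exists2 k : nat, (6 <= k)%N & N = (3 * k + 1)%N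
    | exists2 k : nat, (3 <= k)%N & N = (3 * k + 2)%N].
Proof.
rewrite -half_designP//; split => [[x [xd xq xa]]|[s hs]].
  exact: design_half_design xd xq xa.
exact: half_design_design hs.
Qed.
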